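(* Let $0<a<1$ and let $M$ be a closed invariant subspace of $C_{\phi_a}$ on $H^2(\mathbb{D})$. Then $M$ contains a nonzero $\mathbf{EB}$ function if and only if it contains a nonzero $H^\infty$ function. Additionally, if such an $M$ (containing a nonzero $\mathbf{EB}$ function) is minimal, then $M=K_f$ for some $f\in H^\infty$.
   Context: $H^2=H^2(\mathbb{D})$ is the Hardy-Hilbert space of holomorphic functions on the open unit disk $\mathbb{D}$, and $H^\infty$ is the space of bounded holomorphic functions on $\mathbb{D}$. For $a\in(0,1)$, $\phi_a(z)=az+1-a$, a holomorphic self-map of $\mathbb{D}$, and $C_{\phi_a}f=f\circ\phi_a$ is the (bounded) composition operator on $H^2$. For $f\in H^2$, $K_f:=\overline{\mathrm{span}\{f,C_{\phi_a}f,C_{\phi_a}^2f,\ldots\}}$ (closure in $H^2$). A minimal invariant subspace of $C_{\phi_a}$ is a nonzero closed invariant subspace whose only closed $C_{\phi_a}$-invariant subspaces are $\{0\}$ and itself. For $n\in\mathbb{N}$ let $D_n:=\phi_{a^n}(\mathbb{D})=a^n\mathbb{D}+1-a^n$, the disk with center $1-a^n$ and radius $a^n$. A holomorphic function on $\mathbb{D}$ is called eventually bounded at $1$ ($\mathbf{EB}$) if it is bounded on $D_n$ for some $n\in\mathbb{N}$. *)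

(* Defs.v *)
From Stdlib Require Export Reals.
From Coquelicot Require Export Coquelicot.

Open Scope R_scope.

(* Functions on the disk are total functions C -> C of which only the
   restriction to the disk matters; identities between functions are therefore
   asserted on the disk only.  A closed subspace (in the sense below)
   automatically contains, with f, every function agreeing with f on the disk,
   because the difference has Hardy norm 0; so comparing two closed subspaces
   as predicates on C -> C is the same as comparing them as sets of functions
   on the disk. *)

Definition disk (z : C) : Prop := Cmod z < 1.

Definition eq_on_disk (f g : C -> C) : Prop := forall z, disk z -> f z = g z.

Definition nonzero_on_disk (f : C -> C) : Prop := ~ eq_on_disk f (fun _ => RtoC 0).

(* Scalars are C_AbsRing, so this is complex differentiability. *)
Definition holomorphic (f : C -> C) : Prop :=
  forall z, disk z -> @ex_derive C_AbsRing C_NormedModule f z.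

Definition bounded_on (S : C -> Prop) (f : C -> C) : Prop :=
  exists B : R, forall z, S z -> Cmod (f z) <= B.

Definition Hinf (f : C -> C) : Prop := holomorphic f /\ bounded_on disk f.

Definition has_taylor (c : nat -> C) (f : C -> C) : Prop :=
  forall z, disk z -> @is_pseries C_AbsRing C_NormedModule c z (f z).

(* The Taylor coefficients c are determined by f on the disk, hence so is N. *)
Definition is_H2norm (f : C -> C) (N : R) : Prop :=
  0 <= N /\
  exists c : nat -> C,
    has_taylor c f /\ is_series (fun n => Cmod (c n) ^ 2) (N ^ 2).

Definition H2 (f : C -> C) : Prop := holomorphic f /\ exists N, is_H2norm f N.

Definition H2closure (S : (C -> C) -> Prop) (g : C -> C) : Prop :=
  H2 g /\
  forall eps : R, 0 < eps ->
    exists h, S h /\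
      exists N, is_H2norm (fun z => (g z - h z)%C) N /\ N < eps.

Definition closed_subspace (M : (C -> C) -> Prop) : Prop :=
  (forall f, M f -> H2 f) /\
  M (fun _ => RtoC 0) /\
  (forall f g, M f -> M g -> M (fun z => (f z + g z)%C)) /\
  (forall (k : C) f, M f -> M (fun z => (k * f z)%C)) /\
  (forall f, H2closure M f -> M f).

Definition phi (a : R) (z : C) : C := (RtoC a * z + 1 - RtoC a)%C.

Definition Cphi (a : R) (f : C -> C) : C -> C := fun z => f (phi a z).

Definition closed_invariant (a : R) (M : (C -> C) -> Prop) : Prop :=
  closed_subspace M /\ forall f, M f -> M (Cphi a f).

Definition same_functions (M N : (C -> C) -> Prop) : Prop :=
  forall f, M f <-> N f.

(* The zero subspace consists of all functions vanishing on the disk. *)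

Definition zero_subspace (f : C -> C) : Prop :=
  eq_on_disk f (fun _ => RtoC 0).

Definition minimal_invariant (a : R) (M : (C -> C) -> Prop) : Prop :=
  closed_invariant a M /\
  ~ same_functions M zero_subspace /\
  forall N, closed_invariant a N -> (forall f, N f -> M f) ->
    same_functions N zero_subspace \/ same_functions N M.

(* Coquelicot's sum_n u m has the m + 1 terms u 0, ..., u m. *)
Definition orbit_span (a : R) (f : C -> C) (h : C -> C) : Prop :=
  exists (m : nat) (k : nat -> C),
    eq_on_disk h
      (fun z => sum_n (fun j => (k j * Nat.iter j (Cphi a) f z)%C) m).

Definition K (a : R) (f : C -> C) : (C -> C) -> Prop :=
  H2closure (orbit_span a f).

Definition Ddisk (a : R) (n : nat) (w : C) : Prop :=
  exists z, disk z /\ w = phi (a ^ n) z.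

Definition EB (a : R) (f : C -> C) : Prop :=
  holomorphic f /\ exists n : nat, bounded_on (Ddisk a n) f.

(* Main.v *)
Require Import Defs.
From Stdlib Require Import Reals Lra Lia.
From Coquelicot Require Import Coquelicot.
Open Scope R_scope.

(** Put b = 1 - a.  The iterates of the symbol stay in the family, because
    phi a (phi b z) = phi (a * b) z; so C_phi^n f is f composed with phi (a^n),
    and it is bounded on the disk exactly when f is bounded on D_n.  Hence the
    n-th iterate of a nonzero EB function of M is a bounded function of M, and
    the first claim needs only that this iterate is still nonzero, i.e. that
    C_phi is injective on H^2 ([Cphi_injective]).

    The analytic core is [H2norm_composition]: C_phi maps H^2 to itself with
    norm at most a^(-1/2).  Expand (a z + b)^n as the sum over k of T n k z^k.
    If f has Taylor coefficients c, then f o phi formally has the coefficients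
    d_k, the sum over n of c_n T n k.  The kernel T is nonnegative, its rows
    have sum (a + b)^n = 1 and its columns have sum
    a^k / (1 - b)^(k + 1) = 1 / a, so Schur's test bounds the square sum of d by
    1 / a times that of c.  That the d_k really are Taylor coefficients of
    f o phi is an exchange of summations, justified by
    |T n 0| + |T n 1 z| + ... <= (a |z| + b)^n with a |z| + b < 1.

    Injectivity then avoids expanding f about the centre of phi(D).  When
    a > 1/2 the image phi(D) contains a neighbourhood of 0, so f o phi = 0 kills
    all Taylor coefficients of f at 0.  In general C_phi is the square of the
    operator with parameter sqrt a, which acts on H^2 by the boundedness
    theorem, and taking square roots repeatedly brings the parameter above 1/2.

    For the second claim, boundedness of C_phi makes K_f a closed invariant
    subspace ([closed_invariant_K]).  If f is the bounded nonzero function found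
    in M, then K_f is a nonzero closed invariant subspace of M, so it is all of
    M by minimality ([minimal_invariant_cyclic]). *)

(** * Finite sums and nonnegative series *)

(** The carrier of a canonical structure on the complex numbers is convertible
    to [C] but does not have the form under which [ring] is registered. *)
Ltac C_ring := match goal with |- ?x = ?y => change (@eq C x y) end; ring.

Lemma sum_n_first (G : AbelianMonoid) (u : nat -> G) (n : nat) :
  sum_n u (S n) = plus (u 0%nat) (sum_n (fun k => u (S k)) n).
Proof.
  induction n as [|n IH].
  - now rewrite sum_Sn, !sum_O.
  - now rewrite sum_Sn, IH, (sum_Sn _ n), plus_assoc.
Qed.

Lemma sum_n_le (u v : nat -> R) (n : nat) :
  (forall k, u k <= v k) -> sum_n u n <= sum_n v n.
Proof. intros H. now apply sum_n_m_le. Qed.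

Lemma sum_n_le_series (u : nat -> R) (l : R) (n : nat) :
  (forall k, 0 <= u k) -> is_series u l -> sum_n u n <= l.
Proof.
  intros Hu Hl.
  apply (is_lim_seq_incr_compare (sum_n u) l Hl).
  intros k. rewrite sum_Sn. generalize (Hu (S k)). unfold plus; simpl. lra.
Qed.

Lemma nonneg_series_bounded (u : nat -> R) (B : R) :
  (forall k, 0 <= u k) -> (forall n, sum_n u n <= B) ->
  exists l, is_series u l /\ 0 <= l <= B.
Proof.
  intros Hu HB.
  destruct (ex_finite_lim_seq_incr (sum_n u) B) as [l Hl].
  - intros k. rewrite sum_Sn. generalize (Hu (S k)). unfold plus; simpl. lra.
  - exact HB.
  - exists l. repeat split.
    + exact Hl.
    + apply Rle_trans with (sum_n u 0).
      * rewrite sum_O. apply Hu.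
      * now apply sum_n_le_series.
    + exact (is_lim_seq_le _ _ l B HB Hl (is_lim_seq_const B)).
Qed.

Lemma sum_n_Cmult_l (x : C) (u : nat -> C) (n : nat) :
  sum_n (fun k => x * u k)%C n = (x * sum_n u n)%C.
Proof. exact (sum_n_mult_l (K := C_Ring) x u n). Qed.

Lemma sum_n_Cplus (u v : nat -> C) (n : nat) :
  sum_n (fun k => u k + v k)%C n = (sum_n u n + sum_n v n)%C.
Proof. exact (sum_n_plus (G := C_AbelianMonoid) u v n). Qed.

Lemma sum_n_Rmult_l (x : R) (u : nat -> R) (n : nat) :
  sum_n (fun k => x * u k) n = x * sum_n u n.
Proof. exact (sum_n_mult_l (K := R_Ring) x u n). Qed.

Lemma sum_n_Rplus (u v : nat -> R) (n : nat) :
  sum_n (fun k => u k + v k) n = sum_n u n + sum_n v n.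
Proof. exact (sum_n_plus (G := R_AbelianMonoid) u v n). Qed.

Lemma Cmod_sum_n (u : nat -> C) (n : nat) :
  Cmod (sum_n u n) <= sum_n (fun k => Cmod (u k)) n.
Proof. exact (norm_sum_n_m (V := C_NormedModule) u 0 n). Qed.

Lemma Cmod_pow_n (z : C) (n : nat) : Cmod (pow_n (K := C_Ring) z n) = Cmod z ^ n.
Proof.
  induction n as [|n IH]; simpl.
  - exact Cmod_1.
  - rewrite <- IH. apply Cmod_mult.
Qed.


(** * Series of complex numbers *)

Lemma is_series_Cmod (u : nat -> C) (l : C) :
  @is_series C_AbsRing C_NormedModule u l <->
  is_lim_seq (fun n => Cmod (sum_n u n - l)%C) 0.
Proof.
  unfold is_series.
  rewrite (filterlim_locally_ball_norm (U := C_NormedModule) (sum_n u) l).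
  rewrite <- is_lim_seq_spec.
  split; intros H eps; generalize (H eps); apply filter_imp; intros n;
  unfold ball_norm; rewrite Rminus_0_r, Rabs_pos_eq; try apply Cmod_ge_0;
  exact (fun h => h).
Qed.

Lemma fst_sum_n (u : nat -> C) (n : nat) :
  fst (sum_n u n) = sum_n (fun k => fst (u k)) n.
Proof.
  induction n as [|n IH].
  - now rewrite !sum_O.
  - now rewrite !sum_Sn, <- IH.
Qed.

Lemma snd_sum_n (u : nat -> C) (n : nat) :
  snd (sum_n u n) = sum_n (fun k => snd (u k)) n.
Proof.
  induction n as [|n IH].
  - now rewrite !sum_O.
  - now rewrite !sum_Sn, <- IH.
Qed.

Lemma Rabs_fst_le_Cmod (z : C) : Rabs (fst z) <= Cmod z.
Proof. eapply Rle_trans; [apply Rmax_l | apply Rmax_Cmod]. Qed.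

Lemma Rabs_snd_le_Cmod (z : C) : Rabs (snd z) <= Cmod z.
Proof. eapply Rle_trans; [apply Rmax_r | apply Rmax_Cmod]. Qed.

Lemma Cmod_le_Rabs_plus (z : C) : Cmod z <= Rabs (fst z) + Rabs (snd z).
Proof.
  rewrite <- !Cmod_R.
  replace (Cmod (RtoC (snd z))) with (Cmod (Ci * RtoC (snd z))%C).
  - eapply Rle_trans; [| apply Cmod_triangle].
    right. f_equal. destruct z as [x y].
    unfold Ci, RtoC, Cplus, Cmult. simpl. f_equal; ring.
  - rewrite Cmod_mult, Cmod_Ci. ring.
Qed.

Lemma is_series_Rabs (u : nat -> R) (l : R) :
  is_series u l <-> is_lim_seq (fun n => Rabs (sum_n u n - l)) 0.
Proof.
  rewrite <- (is_lim_seq_abs_0 (fun n => sum_n u n - l)).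
  change (is_series u l) with (is_lim_seq (sum_n u) l).
  rewrite <- !is_lim_seq_spec.
  split; intros H eps; generalize (H eps); apply filter_imp; intros n;
  now rewrite Rminus_0_r.
Qed.

Lemma is_series_C_components (u : nat -> C) (l : C) :
  @is_series C_AbsRing C_NormedModule u l <->
  is_series (fun n => fst (u n)) (fst l) /\
  is_series (fun n => snd (u n)) (snd l).
Proof.
  rewrite is_series_Cmod, !is_series_Rabs. split.
  - intros H. split.
    + apply (is_lim_seq_le_le (fun _ => 0) _ (fun n => Cmod (sum_n u n - l)%C));
      [| apply is_lim_seq_const | exact H].
      intros n. split; [apply Rabs_pos |].
      rewrite <- fst_sum_n. exact (Rabs_fst_le_Cmod (sum_n u n - l)%C).
    + apply (is_lim_seq_le_le (fun _ => 0) _ (fun n => Cmod (sum_n u n - l)%C));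
      [| apply is_lim_seq_const | exact H].
      intros n. split; [apply Rabs_pos |].
      rewrite <- snd_sum_n. exact (Rabs_snd_le_Cmod (sum_n u n - l)%C).
  - intros [H1 H2].
    apply (is_lim_seq_le_le (fun _ => 0) _
      (fun n => Rabs (sum_n (fun k => fst (u k)) n - fst l)
              + Rabs (sum_n (fun k => snd (u k)) n - snd l)));
    [| apply is_lim_seq_const |].
    + intros n. split; [apply Cmod_ge_0 |].
      rewrite <- fst_sum_n, <- snd_sum_n.
      exact (Cmod_le_Rabs_plus (sum_n u n - l)%C).
    + rewrite <- (Rplus_0_r 0). now apply is_lim_seq_plus'.
Qed.

(** A majorant controls the distance to the sum by its own tail; stated with an
    upper bound S - S_n so that no series over a shifted index occurs. *)
Lemma series_C_tail (u : nat -> C) (g : nat -> R) (s : C) (S : R) (n : nat) :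
  (forall k, Cmod (u k) <= g k) ->
  @is_series C_AbsRing C_NormedModule u s -> is_series g S ->
  Cmod (s - sum_n u n)%C <= S - sum_n g n.
Proof.
  intros Hug Hs HS.
  assert (Hpart : forall p,
    Cmod (sum_n u (p + n) - sum_n u n)%C <= sum_n g (p + n) - sum_n g n).
  { induction p as [|p IH]; simpl.
    - replace (sum_n u n - sum_n u n)%C with (RtoC 0) by ring.
      rewrite Cmod_0. lra.
    - rewrite !sum_Sn.
      replace (plus (sum_n u (p + n)) (u (Datatypes.S (p + n))) - sum_n u n)%C
        with (sum_n u (p + n) - sum_n u n + u (Datatypes.S (p + n)))%C
        by (unfold plus; simpl; ring).
      eapply Rle_trans; [apply Cmod_triangle |].
      generalize (Hug (Datatypes.S (p + n))%nat). unfold plus; simpl. lra. }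
  apply is_series_Cmod in Hs.
  assert (Hle : forall p, Cmod (s - sum_n u n)%C <=
    (sum_n g (p + n) - sum_n g n) + Cmod (sum_n u (p + n) - s)%C).
  { intros p.
    replace (s - sum_n u n)%C with
      ((sum_n u (p + n) - sum_n u n) + - (sum_n u (p + n) - s))%C by ring.
    eapply Rle_trans; [apply Cmod_triangle |].
    rewrite Cmod_opp. generalize (Hpart p). lra. }
  rewrite <- (Rplus_0_r (S - sum_n g n)).
  apply (is_lim_seq_le _ _ (Cmod (s - sum_n u n)%C) (S - sum_n g n + 0) Hle
           (is_lim_seq_const _)).
  apply is_lim_seq_plus'.
  - apply is_lim_seq_minus'; [| apply is_lim_seq_const].
    now apply (is_lim_seq_incr_n (sum_n g) n).
  - now apply (is_lim_seq_incr_n (fun p => Cmod (sum_n u p - s)%C) n).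
Qed.

(** * Schur's test *)

Lemma weighted_cauchy_schwarz (t x : nat -> R) (n : nat) :
  (forall k, 0 <= t k) -> (forall k, 0 <= x k) ->
  sum_n (fun k => t k * x k) n ^ 2 <=
  sum_n t n * sum_n (fun k => t k * x k ^ 2) n.
Proof.
  intros Ht Hx.
  assert (Hpos : forall k, 0 <= sum_n t k /\ 0 <= sum_n (fun k => t k * x k) k
                        /\ 0 <= sum_n (fun k => t k * x k ^ 2) k).
  { induction k as [|k [H1 [H2 H3]]].
    - rewrite !sum_O. generalize (Ht 0%nat) (Hx 0%nat); intros; nra.
    - rewrite !sum_Sn. unfold plus; simpl.
      generalize (Ht (S k)) (Hx (S k)); intros; simpl in *; repeat split; nra. }
  induction n as [|n IH].
  - rewrite !sum_O. right. ring.
  - rewrite !sum_Sn. unfold plus; simpl.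
    destruct (Hpos n) as [H1 [H2 H3]].
    specialize (Ht (S n)). specialize (Hx (S n)).
    set (P := sum_n t n) in *.
    set (X := sum_n (fun k => t k * x k) n) in *.
    set (Q := sum_n (fun k => t k * x k ^ 2) n) in *.
    change (sum_n (fun k => t k * (x k * (x k * 1))) n) with Q.
    set (s := t (S n)) in *. set (y := x (S n)) in *.
    (* This is the arithmetic-geometric mean inequality for Q and P y^2, whose
       product is at least (X y)^2 by the induction hypothesis. *)
    assert (Hcross : 2 * X * y <= Q + P * y ^ 2).
    { apply Rsqr_incr_0_var; [| nra].
      unfold Rsqr. generalize (pow2_ge_0 (Q - P * y ^ 2)).
      assert (X ^ 2 * y ^ 2 <= P * Q * y ^ 2) by (apply Rmult_le_compat_r; nra).
      nra. }
    assert (s * (2 * X * y) <= s * (Q + P * y ^ 2)) by (apply Rmult_le_compat_l; lra).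
    nra.
Qed.

(** Cauchy-Schwarz with the weights [T n k], n varying, costs one column sum
    B; exchanging the two summations then leaves the row sums, at most 1. *)
Lemma schur_test (T : nat -> nat -> R) (B : R) (c : nat -> C) (m p : nat) :
  (forall n k, 0 <= T n k) ->
  (forall n q, sum_n (T n) q <= 1) ->
  (forall k q, sum_n (fun n => T n k) q <= B) ->
  sum_n (fun k => Cmod (sum_n (fun n => c n * RtoC (T n k))%C m) ^ 2) p <=
  B * sum_n (fun n => Cmod (c n) ^ 2) m.
Proof.
  intros HT Hrow Hcol.
  assert (HB : 0 <= B).
  { apply Rle_trans with (2 := Hcol 0%nat 0%nat). rewrite sum_O. apply HT. }
  apply Rle_trans with
    (sum_n (fun k => B * sum_n (fun n => T n k * Cmod (c n) ^ 2) m) p).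
  - apply sum_n_le. intros k.
    apply Rle_trans with (sum_n (fun n => T n k * Cmod (c n)) m ^ 2).
    + apply pow_incr. split; [apply Cmod_ge_0 |].
      eapply Rle_trans; [apply Cmod_sum_n |].
      apply sum_n_le. intros n.
      rewrite Cmod_mult, Cmod_R, Rabs_pos_eq by apply HT. lra.
    + eapply Rle_trans.
      * apply weighted_cauchy_schwarz; [intros; apply HT | intros; apply Cmod_ge_0].
      * apply Rmult_le_compat_r; [| apply Hcol].
        apply Rle_trans with (sum_n (fun _ : nat => 0) m).
        { rewrite sum_n_const. lra. }
        apply sum_n_le. intros n. apply Rmult_le_pos; [apply HT | apply pow2_ge_0].
  - rewrite sum_n_Rmult_l.
    apply Rmult_le_compat_l; [exact HB |].
    rewrite (sum_n_switch (fun k n => T n k * Cmod (c n) ^ 2)).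
    apply sum_n_le. intros n.
    rewrite (sum_n_mult_r (K := R_Ring)).
    change (sum_n (T n) p * Cmod (c n) ^ 2 <= Cmod (c n) ^ 2).
    generalize (Hrow n p) (pow2_ge_0 (Cmod (c n))).
    set (w := Cmod (c n) ^ 2). nra.
Qed.

(** * The matrix of composition with an affine map *)

(** The coefficient of z^k in (a z + 1 - a)^n.  The Pascal-type recursion, rather
    than the binomial formula, makes it vanish for k > n and gives the row and
    column sums by induction. *)
Fixpoint affine_power_coef (a : R) (n k : nat) : R :=
  match n, k with
  | O, O => 1
  | O, S _ => 0
  | S n', O => (1 - a) * affine_power_coef a n' O
  | S n', S k' =>
      a * affine_power_coef a n' k' + (1 - a) * affine_power_coef a n' (S k')
  end.

Lemma affine_power_coef_pos (a : R) (n k : nat) :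
  0 < a < 1 -> 0 <= affine_power_coef a n k.
Proof.
  intros Ha. revert k. induction n as [|n IH]; intros [|k]; simpl; try lra.
  - generalize (IH 0%nat). nra.
  - generalize (IH k) (IH (S k)). nra.
Qed.

Lemma affine_power_expansion (a : R) (z : C) (n p : nat) :
  (n <= p)%nat ->
  sum_n (fun k => pow_n (K := C_Ring) z k * RtoC (affine_power_coef a n k))%C p =
  pow_n (K := C_Ring) (phi a z) n.
Proof.
  revert p. induction n as [|n IH]; intros p Hp.
  - clear Hp. induction p as [|p IH].
    + rewrite sum_O. simpl. unfold one; simpl. ring.
    + rewrite sum_Sn, IH. simpl. unfold plus, one; simpl. ring.
  - destruct p as [|p]; [lia |].
    rewrite sum_n_first.
    assert (Hp' : (n <= p)%nat) by lia.
    change (pow_n (phi a z) (S n)) with (phi a z * pow_n (K := C_Ring) (phi a z) n)%C.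
    transitivity
      (RtoC a * z * sum_n (fun k => pow_n (K := C_Ring) z k * RtoC (affine_power_coef a n k))%C p
       + RtoC (1 - a) * sum_n (fun k => pow_n (K := C_Ring) z k * RtoC (affine_power_coef a n k))%C (S p))%C.
    + rewrite (sum_n_first C_AbelianMonoid _ p), <- !sum_n_Cmult_l.
      rewrite Cmult_plus_distr_l, <- sum_n_Cmult_l.
      rewrite (sum_n_ext _ (fun k =>
         (RtoC a * z * (pow_n (K := C_Ring) z k * RtoC (affine_power_coef a n k))
          + RtoC (1 - a) *
            (pow_n (K := C_Ring) z (S k) * RtoC (affine_power_coef a n (S k))))%C)).
      2:{ intros k. simpl. unfold mult; simpl.
          rewrite RtoC_plus, !RtoC_mult. ring. }
      rewrite sum_n_Cplus. simpl. unfold one; simpl. rewrite RtoC_mult.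
      change (@plus C_AbelianMonoid) with Cplus.
      C_ring.
    + rewrite (IH p Hp'), (IH (S p)) by lia.
      unfold phi. rewrite RtoC_minus. C_ring.
Qed.

Lemma affine_power_coef_sum_le (a r : R) (n p : nat) :
  0 < a < 1 -> 0 <= r ->
  sum_n (fun k => r ^ k * affine_power_coef a n k) p <= (a * r + (1 - a)) ^ n.
Proof.
  intros Ha Hr. revert p. induction n as [|n IH]; intros p.
  - right. induction p as [|p IH].
    + rewrite sum_O. simpl. ring.
    + rewrite sum_Sn, IH. simpl. unfold plus; simpl. ring.
  - change ((a * r + (1 - a)) ^ S n)
      with ((a * r + (1 - a)) * (a * r + (1 - a)) ^ n).
    assert (0 <= a * r) by nra.
    destruct p as [|p].
    + generalize (IH 0%nat). rewrite !sum_O. simpl.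
      generalize (affine_power_coef_pos a n 0 Ha).
      set (y := affine_power_coef a n 0). set (w := (a * r + (1 - a)) ^ n). nra.
    + apply Rle_trans with
      (a * r * sum_n (fun k => r ^ k * affine_power_coef a n k) p
       + (1 - a) * sum_n (fun k => r ^ k * affine_power_coef a n k) (S p)).
      * right. rewrite !(sum_n_first R_AbelianMonoid _ p).
        change (@plus R_AbelianMonoid) with Rplus.
        rewrite Rmult_plus_distr_l, <- !sum_n_Rmult_l.
        rewrite (sum_n_ext _ (fun k =>
          a * r * (r ^ k * affine_power_coef a n k)
          + (1 - a) * (r ^ (S k) * affine_power_coef a n (S k)))).
        2:{ intros k. simpl. ring. }
        rewrite sum_n_Rplus. simpl. ring.
      * generalize (IH p) (IH (S p)).
        set (w := (a * r + (1 - a)) ^ n). nra.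
Qed.

Lemma affine_power_coef_row (a : R) (n p : nat) :
  0 < a < 1 -> sum_n (affine_power_coef a n) p <= 1.
Proof.
  intros Ha. generalize (affine_power_coef_sum_le a 1 n p Ha Rle_0_1).
  replace (a * 1 + (1 - a)) with 1 by ring. rewrite pow1.
  intros H. eapply Rle_trans; [| exact H].
  apply sum_n_le. intros k. rewrite pow1. lra.
Qed.

Lemma affine_power_coef_le_1 (a : R) (n k : nat) :
  0 < a < 1 -> affine_power_coef a n k <= 1.
Proof.
  intros Ha. apply Rle_trans with (2 := affine_power_coef_row a n k Ha).
  destruct k as [|k]; [rewrite sum_O; lra |].
  rewrite sum_Sn.
  assert (0 <= sum_n (affine_power_coef a n) k).
  { apply Rle_trans with (sum_n (fun _ : nat => 0) k).
    - rewrite sum_n_const. lra.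
    - apply sum_n_le. intros j. now apply affine_power_coef_pos. }
  unfold plus; simpl. lra.
Qed.

(** The full column sum is s_k = a s_{k-1} + (1 - a) s_k with
    s_0 = 1 / (1 - (1 - a)), which forces s_k = 1 / a; for partial sums the same
    recursion yields an inequality. *)
Lemma affine_power_coef_column (a : R) (k m : nat) :
  0 < a < 1 -> sum_n (fun n => affine_power_coef a n k) m <= / a.
Proof.
  intros Ha.
  assert (Hinv : a * / a = 1) by (apply Rinv_r; lra).
  assert (0 < / a) by (apply Rinv_0_lt_compat; lra).
  revert m. induction k as [|k IHk]; induction m as [|m IHm].
  - rewrite sum_O. simpl. nra.
  - rewrite sum_n_first. simpl.
    rewrite sum_n_Rmult_l. unfold plus; simpl. nra.
  - rewrite sum_O. simpl. lra.
  - rewrite sum_n_first. simpl.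
    rewrite sum_n_Rplus, !sum_n_Rmult_l. unfold plus; simpl.
    generalize (IHk m). nra.
Qed.
(** * Boundedness of the composition operator *)

Lemma is_lim_seq_Cmod_partial_sums (u : nat -> C) (l : C) :
  @is_series C_AbsRing C_NormedModule u l ->
  is_lim_seq (fun m => Cmod (sum_n u m)) (Cmod l).
Proof.
  intros H.
  exact (filterlim_comp _ _ _ _ _ _ _ _ H (filterlim_norm (V := C_NormedModule) l)).
Qed.

Lemma is_series_C_sum_n (u : nat -> nat -> C) (l : nat -> C) (p : nat) :
  (forall k, @is_series C_AbsRing C_NormedModule (u k) (l k)) ->
  @is_series C_AbsRing C_NormedModule
    (fun n => sum_n (fun k => u k n) p) (sum_n l p).
Proof.
  intros H. induction p as [|p IH].
  - rewrite sum_O. apply is_series_ext with (2 := H 0%nat).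
    intros n. now rewrite sum_O.
  - rewrite sum_Sn.
    apply is_series_ext with (2 := is_series_plus _ _ _ _ IH (H (S p))).
    intros n. now rewrite sum_Sn.
Qed.

Lemma phi_phi (a b : R) (z : C) : phi a (phi b z) = phi (a * b) z.
Proof. unfold phi. rewrite RtoC_mult. ring. Qed.

Lemma Cmod_phi_le (a : R) (z : C) :
  0 < a < 1 -> Cmod (phi a z) <= a * Cmod z + (1 - a).
Proof.
  intros Ha. unfold phi.
  replace (RtoC a * z + 1 - RtoC a)%C with (RtoC a * z + RtoC (1 - a))%C
    by (rewrite RtoC_minus; ring).
  eapply Rle_trans; [apply Cmod_triangle |].
  rewrite Cmod_mult, !Cmod_R, !Rabs_pos_eq by lra. lra.
Qed.

Lemma phi_disk (a : R) (z : C) : 0 < a < 1 -> disk z -> disk (phi a z).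
Proof.
  unfold disk. intros Ha Hz. generalize (Cmod_phi_le a z Ha). nra.
Qed.

Lemma square_summable_H2norm (c : nat -> C) (f : C -> C) (B : R) :
  has_taylor c f -> (forall p, sum_n (fun k => Cmod (c k) ^ 2) p <= B) ->
  exists N, is_H2norm f N /\ N ^ 2 <= B.
Proof.
  intros Hc HB.
  destruct (nonneg_series_bounded _ B (fun k => pow2_ge_0 (Cmod (c k))) HB)
    as [l [Hl [Hl0 HlB]]].
  exists (sqrt l). rewrite pow2_sqrt by exact Hl0.
  repeat split; [apply sqrt_pos | | exact HlB].
  exists c. rewrite pow2_sqrt by exact Hl0. now split.
Qed.

(** The new coefficients are the column-wise sums of c_n T n k.  Their square sum
    is bounded by [schur_test], first for the truncations n <= m and then in the
    limit m -> oo. *)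
Lemma H2norm_composition (a : R) (f : C -> C) (N : R) :
  0 < a < 1 -> is_H2norm f N ->
  exists N', is_H2norm (Cphi a f) N' /\ N' ^ 2 <= / a * N ^ 2.
Proof.
  intros Ha [_ [c [Hc HN]]].
  set (T := affine_power_coef a).
  assert (HT : forall n k, 0 <= T n k) by (intros; now apply affine_power_coef_pos).
  assert (Hinv : 0 < / a) by (apply Rinv_0_lt_compat; lra).
  set (u := fun k n => (c n * RtoC (T n k))%C).
  (* Summing the two coordinates separately gives d as an explicit function of k. *)
  set (d := fun k => (Series (fun n => fst (u k n)), Series (fun n => snd (u k n))) : C).
  assert (Hd : forall k, @is_series C_AbsRing C_NormedModule (u k) (d k)).
  { intros k.
    assert (Hex : @ex_series C_AbsRing C_NormedModule (u k)).
    { destruct (nonneg_series_bounded (fun n => T n k) (/ a)) as [t [Ht _]].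
      - intros n. apply HT.
      - intros m. now apply affine_power_coef_column.
      - (* |c| T <= T^2 + |c|^2 <= T + |c|^2, and both terms are summable in n. *)
        apply (ex_series_le (V := C_CompleteNormedModule) (u k)
                 (fun n => plus (T n k) (Cmod (c n) ^ 2))).
        + intros n. change (Cmod (u k n) <= T n k + Cmod (c n) ^ 2).
          unfold u. rewrite Cmod_mult, Cmod_R, Rabs_pos_eq by apply HT.
          assert (HT1 : T n k <= 1) by now apply affine_power_coef_le_1.
          generalize (HT n k) (Cmod_ge_0 (c n)).
          set (t' := T n k) in *. set (x := Cmod (c n)). intros H0 H1.
          generalize (pow2_ge_0 (x - t')). nra.
        + exists (plus t (N ^ 2)). exact (is_series_plus _ _ _ _ Ht HN). }
    destruct Hex as [l Hl].
    replace (d k) with l; [exact Hl |].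
    apply is_series_C_components in Hl. destruct Hl as [H1 H2].
    apply is_series_unique in H1. apply is_series_unique in H2.
    unfold d. rewrite H1, H2. now destruct l. }
  apply (square_summable_H2norm d).
  - intros z Hz. unfold is_pseries.
    set (w := phi a z).
    assert (Hw : disk w) by now apply phi_disk.
    set (rho := a * Cmod z + (1 - a)).
    assert (Hrho : 0 <= rho < 1).
    { unfold rho. unfold disk in Hz. generalize (Cmod_ge_0 z). nra. }
    assert (HS : ex_series (fun n => Cmod (c n) * rho ^ n)).
    { apply (ex_series_le (V := R_CompleteNormedModule) _
               (fun n => plus ((rho ^ 2) ^ n) (Cmod (c n) ^ 2))).
      - intros n.
        change (Rabs (Cmod (c n) * rho ^ n) <= (rho ^ 2) ^ n + Cmod (c n) ^ 2).
        rewrite <- pow_mult, (Nat.mul_comm 2 n), pow_mult.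
        assert (0 <= rho ^ n) by (apply pow_le; lra).
        generalize (Cmod_ge_0 (c n)).
        set (x := Cmod (c n)). set (y := rho ^ n) in *. intros Hx.
        rewrite Rabs_pos_eq by nra. generalize (pow2_ge_0 (x - y)). nra.
      - apply (ex_series_plus (fun n => (rho ^ 2) ^ n)).
        + apply ex_series_geom. rewrite Rabs_pos_eq by nra. nra.
        + now exists (N ^ 2). }
    destruct HS as [S HS].
    (* For n <= p the truncation of (a z + 1 - a)^n at degree p is exact.  So the
       partial sums s of the new series and t of the old one, both up to p, differ
       only by terms with n > p, and the tail of the majorant |c_n| rho^n bounds
       them. *)
    apply is_series_Cmod.
    specialize (Hc w Hw). apply is_series_Cmod in Hc.
    apply (is_lim_seq_le_le (fun _ => 0) _
      (fun p => (S - sum_n (fun n => Cmod (c n) * rho ^ n) p)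
        + Cmod (sum_n (fun n => scal (pow_n (K := C_Ring) w n) (c n)) p - f w)%C));
    [| apply is_lim_seq_const |].
    + intros p. split; [apply Cmod_ge_0 |].
      set (v := fun n => sum_n (fun k => pow_n (K := C_Ring) z k * u k n)%C p).
      assert (Hv : @is_series C_AbsRing C_NormedModule v
        (sum_n (fun k => scal (pow_n (K := C_Ring) z k) (d k)) p)).
      { apply (is_series_C_sum_n (fun k n => pow_n (K := C_Ring) z k * u k n)%C).
        intros k.
        exact (is_series_scal (V := C_NormedModule) (pow_n (K := C_Ring) z k) _ _ (Hd k)). }
      assert (Hfactor : forall n, v n = (c n *
        sum_n (fun k => pow_n (K := C_Ring) z k * RtoC (T n k)) p)%C).
      { intros n. rewrite <- sum_n_Cmult_l. apply sum_n_ext. intros k.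
        unfold u. C_ring. }
      assert (Hvg : forall n, Cmod (v n) <= Cmod (c n) * rho ^ n).
      { intros n. rewrite Hfactor, Cmod_mult.
        apply Rmult_le_compat_l; [apply Cmod_ge_0 |].
        eapply Rle_trans; [apply Cmod_sum_n |].
        eapply Rle_trans; [| exact (affine_power_coef_sum_le a (Cmod z) n p Ha (Cmod_ge_0 z))].
        apply sum_n_le. intros k.
        rewrite Cmod_mult, Cmod_R, Rabs_pos_eq, Cmod_pow_n by apply HT.
        unfold T. lra. }
      generalize (series_C_tail _ _ _ _ p Hvg Hv HS).
      replace (sum_n v p) with
        (sum_n (fun n => scal (pow_n (K := C_Ring) w n) (c n)) p).
      2:{ apply sum_n_ext_loc. intros n Hn. rewrite Hfactor.
          unfold T. rewrite (affine_power_expansion a z n p Hn).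
          exact (Cmult_comm (pow_n (K := C_Ring) w n) (c n)). }
      set (s := sum_n (fun k => scal _ (d k)) p).
      set (t := sum_n (fun n => scal _ (c n)) p).
      intros Htail.
      change (Cmod (s - f w)%C <=
        S - sum_n (fun n => Cmod (c n) * rho ^ n) p + Cmod (t - f w)%C).
      replace (s - f w)%C with ((s - t) + (t - f w))%C by ring.
      eapply Rle_trans; [apply Cmod_triangle |]. lra.
    + rewrite <- (Rplus_0_r 0).
      apply is_lim_seq_plus'; [| exact Hc].
      rewrite <- (Rminus_diag S).
      apply is_lim_seq_minus'; [apply is_lim_seq_const | exact HS].
  - intros p.
    assert (Hlim : is_lim_seq
      (fun m => sum_n (fun k => Cmod (sum_n (u k) m) ^ 2) p)
      (sum_n (fun k => Cmod (d k) ^ 2) p)).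
    { assert (Hone : forall k, is_lim_seq (fun m => Cmod (sum_n (u k) m) ^ 2)
                                          (Cmod (d k) ^ 2)).
      { intros k. simpl.
        apply is_lim_seq_mult'; [| apply is_lim_seq_mult'];
          try apply is_lim_seq_Cmod_partial_sums; try apply Hd.
        apply is_lim_seq_const. }
      induction p as [|p IH].
      - rewrite sum_O. apply is_lim_seq_ext with (2 := Hone 0%nat).
        intros m. now rewrite sum_O.
      - rewrite sum_Sn.
        apply is_lim_seq_ext with (2 := is_lim_seq_plus' _ _ _ _ IH (Hone (S p))).
        intros m. now rewrite sum_Sn. }
    apply (is_lim_seq_le _ (fun _ => / a * N ^ 2) (Finite _) (Finite (/ a * N ^ 2))
             (fun m => Rle_trans _ _ _
                (schur_test T (/ a) c m p HT
                   (fun n q => affine_power_coef_row a n q Ha)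
                   (fun k q => affine_power_coef_column a k q Ha))
                (Rmult_le_compat_l _ _ _ (Rlt_le _ _ Hinv)
                   (sum_n_le_series _ _ m (fun k => pow2_ge_0 (Cmod (c k))) HN)))
             Hlim).
    apply is_lim_seq_const.
Qed.

(** * Linear structure of H^2 *)

Lemma H2norm_ext (f g : C -> C) (N : R) :
  eq_on_disk f g -> is_H2norm f N -> is_H2norm g N.
Proof.
  intros Hfg [HN [c [Hc Hs]]]. split; [exact HN |].
  exists c. split; [| exact Hs].
  intros z Hz. rewrite <- (Hfg z Hz). now apply Hc.
Qed.

Lemma H2norm_zero : is_H2norm (fun _ => RtoC 0) 0.
Proof.
  split; [lra |]. exists (fun _ => RtoC 0). split.
  - intros z _. apply is_series_Cmod.
    apply is_lim_seq_ext with (2 := is_lim_seq_const 0).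
    intros n.
    rewrite (sum_n_ext _ (fun k => RtoC 0 * RtoC 0)%C).
    2:{ intros k. change (pow_n (K := C_Ring) z k * RtoC 0 = RtoC 0 * RtoC 0)%C. ring. }
    rewrite sum_n_Cmult_l, Cmult_0_l.
    replace (0 - 0)%C with (RtoC 0) by ring. now rewrite Cmod_0.
  - replace (0 ^ 2) with 0 by ring.
    change (is_lim_seq (sum_n (fun _ => Cmod 0 ^ 2)) 0).
    apply is_lim_seq_ext with (2 := is_lim_seq_const 0).
    intros n. rewrite Cmod_0, sum_n_const. ring.
Qed.

(** This crude form of the triangle inequality, which follows termwise from
    |x + y|^2 <= 2 (|x|^2 + |y|^2), suffices for all closure arguments. *)
Lemma H2norm_plus (f g : C -> C) (N1 N2 : R) :
  is_H2norm f N1 -> is_H2norm g N2 ->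
  exists N, is_H2norm (fun z => f z + g z)%C N /\ N ^ 2 <= 2 * (N1 ^ 2 + N2 ^ 2).
Proof.
  intros [_ [c [Hc HN1]]] [_ [d [Hd HN2]]].
  apply (square_summable_H2norm (fun n => c n + d n)%C).
  - intros z Hz.
    exact (is_pseries_plus (V := C_NormedModule) c d z _ _ (Hc z Hz) (Hd z Hz)).
  - intros p.
    apply Rle_trans with
      (sum_n (fun k => 2 * (Cmod (c k) ^ 2 + Cmod (d k) ^ 2)) p).
    + apply sum_n_le. intros k.
      generalize (Cmod_triangle (c k) (d k)) (Cmod_ge_0 (c k + d k)).
      set (x := Cmod (c k)). set (y := Cmod (d k)). set (t := Cmod (c k + d k)).
      intros H1 H2. generalize (pow2_ge_0 (x - y)). nra.
    + rewrite sum_n_Rmult_l, sum_n_Rplus.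
      generalize (sum_n_le_series _ _ p (fun k => pow2_ge_0 (Cmod (c k))) HN1)
        (sum_n_le_series _ _ p (fun k => pow2_ge_0 (Cmod (d k))) HN2). lra.
Qed.

Lemma H2norm_scal (x : C) (f : C -> C) (N : R) :
  is_H2norm f N -> is_H2norm (fun z => x * f z)%C (Cmod x * N).
Proof.
  intros [HN [c [Hc Hs]]].
  split; [apply Rmult_le_pos; [apply Cmod_ge_0 | exact HN] |].
  exists (fun n => x * c n)%C. split.
  - intros z Hz.
    apply (is_series_ext (fun n => scal x (scal (pow_n (K := C_Ring) z n) (c n)))).
    + intros n.
      change (x * (pow_n (K := C_Ring) z n * c n) =
              pow_n (K := C_Ring) z n * (x * c n))%C. ring.
    + exact (is_series_scal (V := C_NormedModule) x _ _ (Hc z Hz)).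
  - rewrite Rpow_mult_distr.
    apply is_series_ext with (2 := is_series_scal (Cmod x ^ 2) _ _ Hs).
    intros n. rewrite Cmod_mult, Rpow_mult_distr. reflexivity.
Qed.

Lemma locally_disk (z : C) : disk z -> @locally (AbsRing_UniformSpace C_AbsRing) z disk.
Proof.
  intros Hz.
  assert (He : 0 < 1 - Cmod z) by (unfold disk in Hz; lra).
  exists (mkposreal _ He). intros y Hy.
  change (Cmod (y - z)%C < 1 - Cmod z) in Hy.
  unfold disk. replace y with ((y - z) + z)%C by ring.
  eapply Rle_lt_trans; [apply Cmod_triangle | lra].
Qed.

Lemma holomorphic_ext (f g : C -> C) :
  eq_on_disk f g -> holomorphic f -> holomorphic g.
Proof.
  intros Hfg Hf z Hz. apply (ex_derive_ext_loc f g z); [| now apply Hf].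
  apply filter_imp with (2 := locally_disk z Hz). exact Hfg.
Qed.

Lemma holomorphic_const (x : C) : holomorphic (fun _ => x).
Proof. intros z _. apply ex_derive_const. Qed.

Lemma holomorphic_plus (f g : C -> C) :
  holomorphic f -> holomorphic g -> holomorphic (fun z => f z + g z)%C.
Proof.
  intros Hf Hg z Hz. exact (ex_derive_plus f g z (Hf z Hz) (Hg z Hz)).
Qed.

Lemma holomorphic_scal (x : C) (f : C -> C) :
  holomorphic f -> holomorphic (fun z => x * f z)%C.
Proof.
  intros Hf z Hz. destruct (Hf z Hz) as [l Hl].
  exists (x * l)%C.
  apply (filterdiff_ext_lin (U := AbsRing_NormedModule C_AbsRing)
           (V := C_NormedModule) _
           (fun y : C => scal x (scal y l : C_NormedModule))).
  - exact (filterdiff_scal_r_fct (U := AbsRing_NormedModule C_AbsRing)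
             (V := C_NormedModule) x f _ Cmult_comm Hl).
  - intros y. change (x * (y * l) = y * (x * l))%C. ring.
Qed.

Lemma holomorphic_Cphi (a : R) (f : C -> C) :
  0 < a < 1 -> holomorphic f -> holomorphic (Cphi a f).
Proof.
  intros Ha Hf z Hz. destruct (Hf (phi a z) (phi_disk a z Ha Hz)) as [l Hl].
  assert (Hphi : @ex_derive C_AbsRing (AbsRing_NormedModule C_AbsRing) (phi a) z).
  { apply (ex_derive_ext (V := AbsRing_NormedModule C_AbsRing)
             (fun y : C => plus (scal y (RtoC a : AbsRing_NormedModule C_AbsRing)) (RtoC (1 - a)))).
    - intros y. unfold phi. rewrite RtoC_minus.
      change (y * RtoC a + (1 - RtoC a) = RtoC a * y + 1 - RtoC a)%C. ring.
    - eexists.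
      apply (is_derive_plus (V := AbsRing_NormedModule C_AbsRing));
        [| apply is_derive_const].
      apply (is_derive_scal_l (V := AbsRing_NormedModule C_AbsRing)).
      apply is_derive_id. }
  destruct Hphi as [m Hm].
  exists (scal m l). exact (is_derive_comp f (phi a) z l m Hl Hm).
Qed.

Lemma H2_ext (f g : C -> C) : eq_on_disk f g -> H2 f -> H2 g.
Proof.
  intros Hfg [Hf [N HN]]. split; [now apply (holomorphic_ext f) |].
  exists N. now apply (H2norm_ext f).
Qed.

Lemma H2_zero : H2 (fun _ => RtoC 0).
Proof. split; [apply holomorphic_const | exists 0; exact H2norm_zero]. Qed.

Lemma H2_plus (f g : C -> C) : H2 f -> H2 g -> H2 (fun z => f z + g z)%C.
Proof.
  intros [Hf [N1 H1]] [Hg [N2 H2]].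
  split; [now apply holomorphic_plus |].
  destruct (H2norm_plus _ _ _ _ H1 H2) as [N [HN _]]. now exists N.
Qed.

Lemma H2_scal (x : C) (f : C -> C) : H2 f -> H2 (fun z => x * f z)%C.
Proof.
  intros [Hf [N HN]]. split; [now apply holomorphic_scal |].
  exists (Cmod x * N). now apply H2norm_scal.
Qed.

Lemma H2_Cphi (a : R) (f : C -> C) : 0 < a < 1 -> H2 f -> H2 (Cphi a f).
Proof.
  intros Ha [Hf [N HN]]. split; [now apply holomorphic_Cphi |].
  destruct (H2norm_composition a f N Ha HN) as [N' [HN' _]]. now exists N'.
Qed.

(** * Injectivity of the composition operator *)

(** On the real axis the series splits into two real power series, to which the
    uniqueness theorem for real power series applies. *)
Lemma taylor_coef_zero (c : nat -> C) (f : C -> C) (e : R) :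
  0 < e -> has_taylor c f -> (forall z, Cmod z < e -> f z = 0) ->
  forall n, c n = 0.
Proof.
  intros He Hc Hf.
  (* Half of the minimum, so that the closed interval [-r, r] is admissible. *)
  set (r := Rmin e 1 / 2).
  assert (Hr : 0 < r /\ r < e /\ r < 1).
  { unfold r. generalize (Rmin_l e 1) (Rmin_r e 1) (Rmin_glb_lt e 1 0 He Rlt_0_1).
    lra. }
  assert (Hreal : forall x, Rabs x <= r ->
    is_pseries (fun n => fst (c n)) x 0 /\ is_pseries (fun n => snd (c n)) x 0).
  { intros x Hx.
    assert (Hx1 : disk x) by (unfold disk; rewrite Cmod_R; lra).
    generalize (Hc x Hx1). rewrite (Hf x) by (rewrite Cmod_R; lra).
    intros H. apply is_series_C_components in H. destruct H as [H1 H2].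
    assert (Hpow : forall n, pow_n (K := C_Ring) (RtoC x) n = RtoC (x ^ n)).
    { induction n as [|n IH]; [reflexivity |].
      simpl. rewrite IH, RtoC_mult. reflexivity. }
    assert (HpowR : forall n, pow_n (K := R_Ring) x n = x ^ n)
      by (intros; apply pow_n_pow).
    split.
    - apply is_series_ext with (2 := H1). intros n.
      change (fst (pow_n (K := C_Ring) (RtoC x) n * c n)%C
              = pow_n (K := R_Ring) x n * fst (c n)).
      rewrite HpowR, Hpow. simpl. ring.
    - apply is_series_ext with (2 := H2). intros n.
      change (snd (pow_n (K := C_Ring) (RtoC x) n * c n)%C
              = pow_n (K := R_Ring) x n * snd (c n)).
      rewrite HpowR, Hpow. simpl. ring. }
  assert (Hzero : forall b : nat -> R,
    (forall x, Rabs x <= r -> is_pseries b x 0) -> forall n, b n = 0).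
  { intros b Hb n.
    apply (PSeries_ext_recip b (fun _ => 0)).
    - apply Rbar_not_le_lt. intros Hle.
      apply (CV_disk_outside b r).
      + eapply Rbar_le_lt_trans; [exact Hle |]. simpl. rewrite Rabs_pos_eq; lra.
      + apply is_lim_seq_ext with (fun n => scal (pow_n (K := R_Ring) r n) (b n)).
        * intros m. rewrite pow_n_pow. apply Rmult_comm.
        * apply ex_series_lim_0. exists 0. apply Hb. rewrite Rabs_pos_eq; lra.
    - now rewrite CV_radius_const_0.
    - exists (mkposreal r (proj1 Hr)). intros x Hx.
      rewrite PSeries_const_0. apply is_pseries_unique. apply Hb.
      change (Rabs (x - 0) < r) in Hx. rewrite Rminus_0_r in Hx. lra. }
  intros n. apply injective_projections.
  - apply (Hzero (fun n => fst (c n))). intros x Hx. exact (proj1 (Hreal x Hx)).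
  - apply (Hzero (fun n => snd (c n))). intros x Hx. exact (proj2 (Hreal x Hx)).
Qed.

Lemma taylor_identity (c : nat -> C) (f : C -> C) (e : R) :
  0 < e -> has_taylor c f -> (forall z, Cmod z < e -> f z = 0) ->
  eq_on_disk f (fun _ => RtoC 0).
Proof.
  intros He Hc Hf z Hz.
  assert (H0 := taylor_coef_zero c f e He Hc Hf).
  generalize (Hc z Hz). intros Hs. apply is_series_Cmod in Hs.
  apply Cmod_eq_0.
  assert (Hlim : is_lim_seq (fun _ => Cmod (f z)) 0).
  { apply is_lim_seq_ext with (2 := Hs). intros n.
    rewrite (sum_n_ext _ (fun k => RtoC 0 * RtoC 0)%C).
    2:{ intros k. rewrite (H0 k).
        change (pow_n (K := C_Ring) z k * RtoC 0 = RtoC 0 * RtoC 0)%C. ring. }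
    rewrite sum_n_Cmult_l, Cmult_0_l.
    rewrite <- (Cmod_opp (f z)). f_equal. ring. }
  apply is_lim_seq_unique in Hlim. rewrite Lim_seq_const in Hlim. now inversion Hlim.
Qed.

(** The image of the disk has centre 1 - a and radius a, so for a > 1/2 it
    contains the disk of radius a - (1 - a) = 2 a - 1 about 0. *)
Lemma Cphi_injective_large (a : R) (f : C -> C) :
  1 / 2 < a < 1 -> H2 f -> zero_subspace (Cphi a f) -> zero_subspace f.
Proof.
  intros Ha [_ [N [_ [c [Hc _]]]]] H.
  apply (taylor_identity c f (2 * a - 1)); [lra | exact Hc |].
  intros w Hw.
  assert (Ha0 : RtoC a <> 0) by (intros E; apply RtoC_inj in E; lra).
  set (z := (RtoC (/ a) * (w - RtoC (1 - a)))%C).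
  assert (Hz : disk z).
  { unfold disk, z. rewrite Cmod_mult, Cmod_R, Rabs_pos_eq
      by (apply Rlt_le, Rinv_0_lt_compat; lra).
    assert (Cmod (w - RtoC (1 - a))%C <= Cmod w + (1 - a)).
    { eapply Rle_trans; [apply Cmod_triangle |].
      rewrite Cmod_opp, Cmod_R, Rabs_pos_eq by lra. lra. }
    apply Rmult_lt_reg_l with a; [lra |].
    rewrite <- Rmult_assoc, Rinv_r, Rmult_1_l by lra. lra. }
  replace w with (phi a z); [exact (H z Hz) |].
  unfold phi, z. rewrite RtoC_inv, RtoC_minus by lra. field. exact Ha0.
Qed.

(** Induction on the number m of square roots needed to bring a above 1/2; each
    step uses that C_phi is the square of the operator with parameter sqrt a. *)
Lemma Cphi_injective (a : R) (f : C -> C) :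
  0 < a < 1 -> H2 f -> zero_subspace (Cphi a f) -> zero_subspace f.
Proof.
  intros Ha.
  assert (Hm : exists m, (1 / 2) ^ (2 ^ m) < a).
  { destruct (pow_lt_1_zero (1 / 2)) with (y := a) as [m Hm].
    - rewrite Rabs_pos_eq; lra.
    - lra.
    - exists m. specialize (Hm (2 ^ m)%nat).
      rewrite Rabs_pos_eq in Hm by (apply pow_le; lra).
      apply Hm. apply Nat.lt_le_incl, Nat.pow_gt_lin_r. lia. }
  destruct Hm as [m Hm]. revert a f Ha Hm.
  induction m as [|m IH]; intros a f Ha Hm Hf H.
  - simpl in Hm. apply (Cphi_injective_large a); [lra | exact Hf | exact H].
  - assert (Hs : 0 < sqrt a < 1).
    { split; [apply sqrt_lt_R0; lra |].
      rewrite <- sqrt_1. apply sqrt_lt_1_alt. lra. }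
    assert (Hms : (1 / 2) ^ 2 ^ m < sqrt a).
    { apply Rsqr_incrst_0; [| apply pow_le; lra | lra].
      rewrite Rsqr_sqrt by lra.
      replace (2 ^ S m)%nat with (2 ^ m + 2 ^ m)%nat in Hm by (simpl; lia).
      rewrite pow_add in Hm. exact Hm. }
    apply (IH (sqrt a) f Hs Hms Hf).
    apply (IH (sqrt a) _ Hs Hms); [now apply H2_Cphi |].
    intros z Hz. unfold Cphi. rewrite phi_phi, sqrt_sqrt by lra.
    exact (H z Hz).
Qed.

Lemma iter_Cphi (a : R) (f : C -> C) (n : nat) (z : C) :
  Nat.iter n (Cphi a) f z = f (phi (a ^ n) z).
Proof.
  revert z. induction n as [|n IH]; intros z.
  - simpl. f_equal. unfold phi. ring.
  - change (Nat.iter n (Cphi a) f (phi a z) = f (phi (a ^ S n) z)).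
    rewrite IH, phi_phi. simpl. now rewrite Rmult_comm.
Qed.

(** * Closed subspaces and closures *)

(** Membership in a closed subspace depends only on the values on the disk, because
    a function vanishing there has norm 0. *)
Lemma closed_subspace_ext (M : (C -> C) -> Prop) (f g : C -> C) :
  closed_subspace M -> eq_on_disk f g -> M f -> M g.
Proof.
  intros [HH2 [_ [_ [_ Hcl]]]] Hfg Hf.
  apply Hcl. split; [now apply (H2_ext f), HH2 |].
  intros eps He. exists f. split; [exact Hf |].
  exists 0. split; [| exact He].
  apply H2norm_ext with (2 := H2norm_zero).
  intros z Hz. rewrite (Hfg z Hz). ring.
Qed.

Lemma H2closure_incl (S : (C -> C) -> Prop) (f : C -> C) :
  H2 f -> S f -> H2closure S f.
Proof.
  intros Hf HS. split; [exact Hf |].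
  intros eps He. exists f. split; [exact HS |].
  exists 0. split; [| exact He].
  apply H2norm_ext with (2 := H2norm_zero). intros z _. ring.
Qed.

Lemma invariant_iter (a : R) (M : (C -> C) -> Prop) (f : C -> C) (n : nat) :
  closed_invariant a M -> M f -> M (Nat.iter n (Cphi a) f).
Proof.
  intros [_ Hinv] Hf. induction n as [|n IH]; [exact Hf |]. exact (Hinv _ IH).
Qed.

Lemma orbit_span_sub (a : R) (M : (C -> C) -> Prop) (f : C -> C) :
  closed_invariant a M -> M f -> forall h, orbit_span a f h -> M h.
Proof.
  intros HM Hf h [m [k Hh]].
  assert (Hsub := proj1 HM).
  apply (closed_subspace_ext M
    (fun z => sum_n (fun j => (k j * Nat.iter j (Cphi a) f z)%C) m) h Hsub).
  { intros z Hz. symmetry. now apply Hh. }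
  clear Hh. destruct Hsub as [_ [_ [Hplus [Hscal _]]]].
  induction m as [|m IH].
  - apply (closed_subspace_ext M (fun z => k 0%nat * Nat.iter 0 (Cphi a) f z)%C);
      [exact (proj1 HM) | intros z _; now rewrite sum_O |].
    now apply Hscal, invariant_iter.
  - apply (closed_subspace_ext M (fun z =>
      sum_n (fun j => (k j * Nat.iter j (Cphi a) f z)%C) m
      + k (S m) * Nat.iter (S m) (Cphi a) f z)%C);
      [exact (proj1 HM) | intros z _; now rewrite sum_Sn |].
    apply Hplus; [exact IH |]. now apply Hscal, invariant_iter.
Qed.

Lemma H2closure_mono (S T : (C -> C) -> Prop) (g : C -> C) :
  (forall h, S h -> T h) -> H2closure S g -> H2closure T g.
Proof.
  intros HST [Hg Happ]. split; [exact Hg |].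
  intros eps He. destruct (Happ eps He) as [h [Hh HN]].
  exists h. split; [now apply HST | exact HN].
Qed.

Lemma H2norm_plus_small (f g : C -> C) (N1 N2 eps : R) :
  0 < eps -> is_H2norm f N1 -> N1 < eps / 2 -> is_H2norm g N2 -> N2 < eps / 2 ->
  exists N, is_H2norm (fun z => f z + g z)%C N /\ N < eps.
Proof.
  intros He H1 Hlt1 H2 Hlt2.
  destruct (H2norm_plus _ _ _ _ H1 H2) as [N [HN Hle]].
  exists N. split; [exact HN |].
  destruct H1 as [H1 _]. destruct H2 as [H2 _].
  apply Rsqr_incrst_0; [| apply HN | lra].
  unfold Rsqr. nra.
Qed.

Lemma H2closure_idempotent (S : (C -> C) -> Prop) (g : C -> C) :
  H2closure (H2closure S) g -> H2closure S g.
Proof.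
  intros [Hg Happ]. split; [exact Hg |].
  intros eps He.
  destruct (Happ (eps / 2)) as [h [[_ Happ'] [N1 [HN1 Hlt1]]]]; [lra |].
  destruct (Happ' (eps / 2)) as [h' [Hh' [N2 [HN2 Hlt2]]]]; [lra |].
  exists h'. split; [exact Hh' |].
  destruct (H2norm_plus_small _ _ _ _ eps He HN1 Hlt1 HN2 Hlt2) as [N [HN Hlt]].
  exists N. split; [| exact Hlt].
  apply H2norm_ext with (2 := HN). intros z _. ring.
Qed.

Lemma closed_subspace_H2closure (S : (C -> C) -> Prop) :
  S (fun _ => RtoC 0) ->
  (forall f g, S f -> S g -> S (fun z => f z + g z)%C) ->
  (forall (x : C) f, S f -> S (fun z => x * f z)%C) ->
  closed_subspace (H2closure S).
Proof.
  intros Hzero Hplus Hscal.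
  split; [| split; [| split; [| split]]].
  - now intros f [Hf _].
  - now apply H2closure_incl; [exact H2_zero |].
  - intros f g [Hf Happf] [Hg Happg].
    split; [now apply H2_plus |]. intros eps He.
    destruct (Happf (eps / 2)) as [h1 [Hh1 [N1 [HN1 Hlt1]]]]; [lra |].
    destruct (Happg (eps / 2)) as [h2 [Hh2 [N2 [HN2 Hlt2]]]]; [lra |].
    exists (fun z => h1 z + h2 z)%C. split; [now apply Hplus |].
    destruct (H2norm_plus_small _ _ _ _ eps He HN1 Hlt1 HN2 Hlt2) as [N [HN Hlt]].
    exists N. split; [| exact Hlt].
    apply H2norm_ext with (2 := HN). intros z _. ring.
  - intros x f [Hf Happ].
    split; [now apply H2_scal |]. intros eps He.
    assert (Hx : 0 < Cmod x + 1) by (generalize (Cmod_ge_0 x); lra).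
    destruct (Happ (eps / (Cmod x + 1))) as [h [Hh [N [HN Hlt]]]];
      [now apply Rdiv_lt_0_compat |].
    exists (fun z => x * h z)%C. split; [now apply Hscal |].
    exists (Cmod x * N). split.
    + apply H2norm_ext with (2 := H2norm_scal x _ _ HN). intros z _. ring.
    + apply Rmult_lt_compat_l with (r := Cmod x + 1) in Hlt; [| exact Hx].
      replace ((Cmod x + 1) * (eps / (Cmod x + 1))) with eps in Hlt by (field; lra).
      destruct HN as [HN _]. lra.
  - intros f. apply H2closure_idempotent.
Qed.

Lemma H2closure_Cphi (a : R) (S : (C -> C) -> Prop) :
  0 < a < 1 -> (forall h, S h -> S (Cphi a h)) ->
  forall g, H2closure S g -> H2closure S (Cphi a g).
Proof.
  intros Ha Hinv g [Hg Happ].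
  split; [now apply H2_Cphi |]. intros eps He.
  destruct (Happ (eps * sqrt a)) as [h [Hh [N [HN Hlt]]]].
  { apply Rmult_lt_0_compat; [exact He |]. apply sqrt_lt_R0. lra. }
  exists (Cphi a h). split; [now apply Hinv |].
  destruct (H2norm_composition a _ N Ha HN) as [N' [HN' Hle]].
  exists N'. split; [exact HN' |].
  assert (HN0 : 0 <= N) by apply HN. assert (HN'0 : 0 <= N') by apply HN'.
  assert (Hsq : N ^ 2 < eps ^ 2 * a).
  { replace (eps ^ 2 * a) with ((eps * sqrt a) ^ 2).
    - simpl. nra.
    - rewrite Rpow_mult_distr, pow2_sqrt by lra. reflexivity. }
  apply Rsqr_incrst_0; [| exact HN'0 | lra].
  apply Rle_lt_trans with (/ a * N ^ 2); [unfold Rsqr; lra |].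
  apply Rmult_lt_reg_l with a; [lra |].
  rewrite <- Rmult_assoc, Rinv_r by lra. unfold Rsqr. lra.
Qed.

(** * Cyclic subspaces *)

(** Padding with zero coefficients allows two elements of an orbit span to be
    written with the same number of terms. *)
Lemma sum_n_padded (k : nat -> C) (u : nat -> C) (m p : nat) :
  (m <= p)%nat ->
  sum_n (fun j => (if Nat.leb j m then k j else RtoC 0) * u j)%C p =
  sum_n (fun j => k j * u j)%C m.
Proof.
  induction 1 as [|p Hp IH].
  - apply sum_n_ext_loc. intros j Hj.
    now rewrite (proj2 (Nat.leb_le j m) Hj).
  - rewrite sum_Sn, IH.
    rewrite (proj2 (Nat.leb_gt (S p) m)) by lia.
    unfold plus; simpl. C_ring.
Qed.

Lemma orbit_span_zero (a : R) (f : C -> C) : orbit_span a f (fun _ => RtoC 0).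
Proof.
  exists 0%nat, (fun _ => RtoC 0). intros z _. rewrite sum_O. ring.
Qed.

Lemma orbit_span_self (a : R) (f : C -> C) : orbit_span a f f.
Proof.
  exists 0%nat, (fun _ => RtoC 1). intros z _. rewrite sum_O. simpl. ring.
Qed.

Lemma orbit_span_plus (a : R) (f g h : C -> C) :
  orbit_span a f g -> orbit_span a f h -> orbit_span a f (fun z => g z + h z)%C.
Proof.
  intros [m [k Hg]] [p [l Hh]].
  exists (max m p), (fun j => (if Nat.leb j m then k j else RtoC 0)
                            + (if Nat.leb j p then l j else RtoC 0))%C.
  intros z Hz. rewrite (Hg z Hz), (Hh z Hz).
  rewrite <- (sum_n_padded k _ m (max m p)) by lia.
  rewrite <- (sum_n_padded l _ p (max m p)) by lia.
  rewrite <- sum_n_Cplus. apply sum_n_ext. intros j. C_ring.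
Qed.

Lemma orbit_span_scal (a : R) (f h : C -> C) (x : C) :
  orbit_span a f h -> orbit_span a f (fun z => x * h z)%C.
Proof.
  intros [m [k Hh]]. exists m, (fun j => x * k j)%C.
  intros z Hz. rewrite (Hh z Hz), <- sum_n_Cmult_l.
  apply sum_n_ext. intros j. C_ring.
Qed.

Lemma orbit_span_Cphi (a : R) (f h : C -> C) :
  0 < a < 1 -> orbit_span a f h -> orbit_span a f (Cphi a h).
Proof.
  intros Ha [m [k Hh]].
  exists (S m), (fun j => match j with O => RtoC 0 | S i => k i end).
  intros z Hz. rewrite sum_n_first, Cmult_0_l.
  change (h (phi a z) =
    0 + sum_n (fun j => k j * Nat.iter j (Cphi a) f (phi a z)) m)%C.
  rewrite Cplus_0_l. apply Hh. now apply phi_disk.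
Qed.

Lemma closed_invariant_K (a : R) (f : C -> C) :
  0 < a < 1 -> closed_invariant a (K a f).
Proof.
  intros Ha. split.
  - apply closed_subspace_H2closure.
    + apply orbit_span_zero.
    + apply orbit_span_plus.
    + intros x g. apply orbit_span_scal.
  - apply H2closure_Cphi; [exact Ha |].
    intros h. now apply orbit_span_Cphi.
Qed.

Lemma K_self (a : R) (f : C -> C) : H2 f -> K a f f.
Proof. intros Hf. apply H2closure_incl; [exact Hf | apply orbit_span_self]. Qed.

Lemma K_sub (a : R) (M : (C -> C) -> Prop) (f : C -> C) :
  closed_invariant a M -> M f -> forall g, K a f g -> M g.
Proof.
  intros HM Hf g Hg.
  assert (Hcl : forall h, H2closure M h -> M h) by apply HM.
  apply Hcl. apply H2closure_mono with (2 := Hg).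
  now apply orbit_span_sub.
Qed.

(** In a minimal invariant subspace every nonzero vector is cyclic. *)
Lemma minimal_invariant_cyclic (a : R) (M : (C -> C) -> Prop) (f : C -> C) :
  0 < a < 1 -> minimal_invariant a M -> M f -> nonzero_on_disk f ->
  same_functions M (K a f).
Proof.
  intros Ha [HM [_ Hmin]] Hf Hnz.
  assert (Hf2 : H2 f) by now apply (proj1 HM).
  destruct (Hmin (K a f) (closed_invariant_K a f Ha) (K_sub a M f HM Hf)) as [H | H].
  - exfalso. apply Hnz, (H f), K_self, Hf2.
  - intros g. now rewrite (H g).
Qed.

(** * Eventually bounded functions *)

Lemma iter_Cphi_nonzero (a : R) (f : C -> C) (n : nat) :
  0 < a < 1 -> H2 f -> nonzero_on_disk f -> nonzero_on_disk (Nat.iter n (Cphi a) f).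
Proof.
  intros Ha Hf Hnz.
  assert (H : H2 (Nat.iter n (Cphi a) f) /\ nonzero_on_disk (Nat.iter n (Cphi a) f)).
  { induction n as [|n [IH2 IHnz]]; [now split |].
    split; [now apply H2_Cphi |].
    intros H. apply IHnz. exact (Cphi_injective a _ Ha IH2 H). }
  apply H.
Qed.

(** The n-th iterate of f has on the disk the values of f on D_n. *)
Lemma EB_to_Hinf (a : R) (M : (C -> C) -> Prop) :
  0 < a < 1 -> closed_invariant a M ->
  (exists f, M f /\ EB a f /\ nonzero_on_disk f) ->
  exists f, M f /\ Hinf f /\ nonzero_on_disk f.
Proof.
  intros Ha HM [f [Hf [[_ [n [B HB]]] Hnz]]].
  assert (HMn := invariant_iter a M f n HM Hf).
  exists (Nat.iter n (Cphi a) f). split; [exact HMn |]. split.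
  - split; [now apply (proj1 HM) |].
    exists B. intros z Hz. rewrite iter_Cphi. apply HB. now exists z.
  - apply iter_Cphi_nonzero; [exact Ha | now apply (proj1 HM) | exact Hnz].
Qed.

Lemma Hinf_EB (a : R) (f : C -> C) : Hinf f -> EB a f.
Proof.
  intros [Hf [B HB]]. split; [exact Hf |]. exists 0%nat, B.
  intros w [z [Hz ->]]. apply HB.
  replace (phi (a ^ 0) z) with z; [exact Hz |].
  unfold phi. simpl. ring.
Qed.

Theorem proposition7 :
  forall (a : R) (M : (C -> C) -> Prop),
    0 < a < 1 ->
    closed_invariant a M ->
    ((exists f, M f /\ EB a f /\ nonzero_on_disk f) <->
     (exists f, M f /\ Hinf f /\ nonzero_on_disk f)) /\
    ((exists f, M f /\ EB a f /\ nonzero_on_disk f) ->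
     minimal_invariant a M ->
     exists f, Hinf f /\ same_functions M (K a f)).
Proof.
  intros a M Ha HM. split; [split |].
  - now apply EB_to_Hinf.
  - intros [f [Hf [Hb Hnz]]]. exists f.
    split; [exact Hf |]. split; [now apply Hinf_EB | exact Hnz].
  - intros HEB Hmin.
    destruct (EB_to_Hinf a M Ha HM HEB) as [f [Hf [Hb Hnz]]].
    exists f. split; [exact Hb |]. now apply minimal_invariant_cyclic.
Qed.
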